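(* Let $M = \{(x,y) : x\in\{1,2\},\ y \in \{0,1,2,3,4\}\}$. The three mesh patterns $(3124,M)$, $(2314,M)$ and $(2413,M)$ are pairwise $\mathrm{des}$-Wilf equivalent, i.e. for all $n\ge 1$, $$\sum_{\sigma \in \mathrm{Av}_n((3124,M))} q^{\mathrm{des}(\sigma)} = \sum_{\sigma \in \mathrm{Av}_n((2314,M))} q^{\mathrm{des}(\sigma)} = \sum_{\sigma \in \mathrm{Av}_n((2413,M))} q^{\mathrm{des}(\sigma)}.$$
   Context: $\mathfrak{S}_n$ is the set of permutations of $[n]=\{1,\dots,n\}$, written in one-line notation $\sigma = a_1\dots a_n$ with $a_i=\sigma(i)$. The descent statistic is $\mathrm{des}(\sigma) = |\{i \in [n-1] : a_i > a_{i+1}\}|$. A mesh pattern is a pair $(\pi,M)$ with $\pi \in \mathfrak{S}_k$ and $M \subseteq \{0,1,\dots,k\}^2$. The element $(x,y)\in M$ represents the shaded unit box with bottom-left corner $(x,y)$ in the plot of $\pi$. A permutation $\sigma \in \mathfrak{S}_n$ contains $(\pi,M)$ if there are positions $1 \le i_1 < \dots < i_k \le n$ such that $a_{i_1}\dots a_{i_k}$ is in the same relative order as $\pi$ and, writing $v_1<\dots<v_k$ for the values $a_{i_1},\dots,a_{i_k}$ in increasing order and setting $i_0=v_0=0$, $i_{k+1}=v_{k+1}=n+1$, for every $(x,y)\in M$ there is no $m$ with $i_x<m<i_{x+1}$ and $v_y<a_m<v_{y+1}$. Otherwise $\sigma$ avoids $(\pi,M)$. $\mathrm{Av}_n((\pi,M))$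 is the set of $\sigma\in\mathfrak{S}_n$ avoiding $(\pi,M)$. *)

(* Defs.v *)
From mathcomp Require Import all_boot all_order all_fingroup all_algebra.

Set Implicit Arguments.
Unset Strict Implicit.
Unset Printing Implicit Defensive.

Import GRing.Theory.

(* A permutation of {1, ..., n} is an s : 'S_n, which permutes {0, ..., n-1}:  *)
(* a_(i+1) is (s i).+1.                                                       *)
Definition one_line (n : nat) (s : 'S_n) : seq nat :=
  [seq (s i).+1 | i <- enum 'I_n].

Section OfOneLine.
Variables (n : nat) (w : seq nat) (wP : perm_eq w (iota 1 n)).

Fact of_one_line_subproof (i : 'I_n) : (nth 0 w i).-1 < n.
Proof.
have: nth 0 w i \in iota 1 n.
  by rewrite -(perm_mem wP) mem_nth // (perm_size wP) size_iota.
by rewrite mem_iota add1n ltnS; case: (nth 0 w i).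
Qed.

Fact of_one_line_inj : injective (fun i => Ordinal (of_one_line_subproof i)).
Proof.
have wpos (i : 'I_n) : 0 < nth 0 w i.
  have: nth 0 w i \in iota 1 n.
    by rewrite -(perm_mem wP) mem_nth // (perm_size wP) size_iota.
  by rewrite mem_iota => /andP[].
have szw : size w = n by rewrite (perm_size wP) size_iota.
have uw : uniq w by rewrite (perm_uniq wP) iota_uniq.
move=> i j /(congr1 val) /= /(congr1 succn); rewrite !prednK // => /eqP.
by rewrite nth_uniq ?szw // => /eqP/val_inj.
Qed.

Definition of_one_line : 'S_n := perm of_one_line_inj.

Lemma of_one_lineK : one_line of_one_line = w.
Proof.
have szw : size w = n by rewrite (perm_size wP) size_iota.
apply: (@eq_from_nth _ 0); first by rewrite size_map size_enum_ord szw.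
move=> k; rewrite size_map size_enum_ord => ltkn.
rewrite (nth_map (Ordinal ltkn)) ?size_enum_ord // permE /=.
rewrite nth_enum_ord // prednK //.
have: nth 0 w k \in iota 1 n by rewrite -(perm_mem wP) mem_nth ?szw.
by rewrite mem_iota => /andP[].
Qed.

End OfOneLine.

Definition des (n : nat) (s : 'S_n) : nat :=
  #|[set i : 'I_n | [exists j : 'I_n, (j == i.+1 :> nat) && (s j < s i)]]|.

Record mesh_pattern (k : nat) := MeshPattern {
  mesh_perm : 'S_k;
  mesh_boxes : {set 'I_k.+1 * 'I_k.+1}
}.

Section Containment.
Variables (k n : nat) (p : mesh_pattern k) (s : 'S_n).

(* i_0 < i_1 < ... < i_k < i_(k+1) and v_0 < v_1 < ... < v_k < v_(k+1), in     *)
(* 1-based coordinates, for the choice of positions f.                        *)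
Definition pos_lines (f : {ffun 'I_k -> 'I_n}) : seq nat :=
  0 :: rcons [seq (f j).+1 | j <- enum 'I_k] n.+1.

Definition val_lines (f : {ffun 'I_k -> 'I_n}) : seq nat :=
  0 :: rcons (sort leq [seq (s (f j)).+1 | j <- enum 'I_k]) n.+1.

Definition in_box (f : {ffun 'I_k -> 'I_n}) (xy : 'I_k.+1 * 'I_k.+1)
    (m : 'I_n) : bool :=
  (nth 0 (pos_lines f) xy.1 < m.+1 < nth 0 (pos_lines f) xy.1.+1) &&
  (nth 0 (val_lines f) xy.2 < (s m).+1 < nth 0 (val_lines f) xy.2.+1).

Definition occurrence (f : {ffun 'I_k -> 'I_n}) : bool :=
  [&& [forall j : 'I_k, forall l : 'I_k, (j < l) ==> (f j < f l)],
      [forall j : 'I_k, forall l : 'I_k,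
         (s (f j) < s (f l)) == (mesh_perm p j < mesh_perm p l)]
    & [forall xy in mesh_boxes p, ~~ [exists m : 'I_n, in_box f xy m]]].

Definition contains : bool := [exists f, occurrence f].

End Containment.

Definition Av (n k : nat) (p : mesh_pattern k) : {set 'S_n} :=
  [set s | ~~ contains p s].

(* The variable q is the polynomial indeterminate 'X. *)
Definition des_poly (n k : nat) (p : mesh_pattern k) : {poly int} :=
  (\sum_(s in Av n p) 'X^(des s))%R.

(* The second coordinate is unconstrained: it ranges over {0, ..., 4}. *)
Definition M : {set 'I_5 * 'I_5} := [set xy | val xy.1 \in [:: 1; 2]].

Definition p3124 : 'S_4 :=
  of_one_line (erefl true : perm_eq [:: 3; 1; 2; 4] (iota 1 4)).
Definition p2314 : 'S_4 :=
  of_one_line (erefl true : perm_eq [:: 2; 3; 1; 4] (iota 1 4)).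
Definition p2413 : 'S_4 :=
  of_one_line (erefl true : perm_eq [:: 2; 4; 1; 3] (iota 1 4)).

(* Main.v *)
(* The shaded columns force the first three letters of an occurrence to be
   adjacent, so a permutation contains the pattern iff its word has a factor
   x y z and a later letter d with y < z < x < d (3124), z < x < y < d (2314) or
   z < x < d < y (2413).

   3124 ~ 2314: cut a word as u m v with m its maximum. An occurrence never
   involves m except in the role of d, so the word avoids the pattern iff u
   avoids the consecutive pattern 312 (resp. 231) and v avoids the pattern.
   Reverse-complementing u inside its set of letters, and recursively treating
   v, exchanges 312 and 231 and preserves the descents.

   2314 ~ 2413: let W(n, b) be the generating polynomial of the avoiders of
   length n + 1 with first letter b. Putting c and then b in front of a word a z
   creates an occurrence starting at b only if a < b < c, and then b c a z has
   exactly one descent more than a z. For fixed a and b, the harmless c > b form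
   a single value, the largest one for 2314 and the smallest one for 2413, so
   that W satisfies the same recursion for both patterns. *)

Require Import Defs.
From mathcomp Require Import all_boot all_order all_fingroup all_algebra.
From mathcomp Require Import zify ring.

Import GRing.Theory.

(** * Avoidance and descents for words *)

Fixpoint avoids (R : nat -> nat -> nat -> nat -> bool) (w : seq nat) : bool :=
  if w is x :: w' then
    (if w' is y :: z :: r then ~~ has (R x y z) r else true) && avoids R w'
  else true.

(** Kept general in [e] because reversing a word turns its descents into ascents. *)
Fixpoint adj_count (e : rel nat) (w : seq nat) : nat :=
  if w is x :: w' then
    (if w' is y :: _ then e x y : nat else 0) + adj_count e w'
  else 0.

Definition word_des : seq nat -> nat := adj_count (fun x y => y < x).

Definition R3124 x y z d := (y < z) && (z < x) && (x < d).
Definition R2314 x y z d := (z < x) && (x < y) && (y < d).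
Definition R2413 x y z d := (z < x) && (x < d) && (d < y).

Lemma avoidsPn (R : nat -> nat -> nat -> nat -> bool) w :
  reflect (exists i d, i.+2 < d < size w /\
             R (nth 0 w i) (nth 0 w i.+1) (nth 0 w i.+2) (nth 0 w d))
          (~~ avoids R w).
Proof.
elim: w => [|x w IHw] /=.
  by apply: ReflectF => -[i [d []]]; rewrite ltn0 andbF.
rewrite negb_and; apply: (iffP orP).
  case=> [|/IHw [i [d [lt_id Rid]]]]; last by exists i.+1, d.+1.
  case: w {IHw} => [|y [|z r]] //; rewrite negbK => /(has_nthP 0) [d lt_d Rd].
  by exists 0, d.+3.
case=> -[|i] [[|d] [//= lt_id Rid]]; last by right; apply/IHw; exists i, d.
left; case: w {IHw} lt_id Rid => [|y [|z r]] /=; case: d => [|[|d]] //= lt_d Rd.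
by rewrite negbK; apply/(has_nthP 0); exists d.
Qed.

Lemma size_one_line n (s : 'S_n) : size (one_line s) = n.
Proof. by rewrite size_map size_enum_ord. Qed.

Lemma nth_one_line n (s : 'S_n) (i : 'I_n) : nth 0 (one_line s) i = (s i).+1.
Proof. by rewrite (nth_map i) ?size_enum_ord // nth_ord_enum. Qed.

Lemma one_line_inj n : injective (@one_line n).
Proof.
move=> s t eq_st; apply/permP => i; apply: val_inj; apply: succn_inj.
by rewrite -!nth_one_line eq_st.
Qed.

Lemma one_line_perm n (s : 'S_n) : perm_eq (one_line s) (iota 1 n).
Proof.
apply: uniq_perm; last 1 first.
- move=> x; rewrite mem_iota; apply/mapP/andP.
    by case=> i _ ->; split; rewrite ?add1n ?ltnS ?ltn_ord.
  case: x => [[]//|x [_]]; rewrite add1n ltnS => lt_xn.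
  by exists (s^-1 (Ordinal lt_xn))%g; rewrite ?mem_enum // permKV.
- by rewrite map_inj_uniq ?enum_uniq // => i j /succn_inj /val_inj /perm_inj.
- exact: iota_uniq.
Qed.

(** The guard [i.+1 < size w] discards the last index, where [nth] would return the default 0 and
    fake a descent. *)
Lemma adj_countE e w :
  adj_count e w =
  \sum_(i < size w) ((i.+1 < size w) && e (nth 0 w i) (nth 0 w i.+1)).
Proof.
elim: w => [|x w IHw]; first by rewrite big_ord0.
by rewrite big_ord_recl /= IHw; case: w {IHw}.
Qed.

Lemma desE n (s : 'S_n) : des s = word_des (one_line s).
Proof.
rewrite /des /word_des adj_countE size_one_line -sum1_card big_mkcond /=.
apply: eq_bigr => i _; rewrite inE.
have -> : [exists j : 'I_n, (j == i.+1 :> nat) && (s j < s i)] =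
  (i.+1 < n) && (nth 0 (one_line s) i.+1 < nth 0 (one_line s) i).
  apply/existsP/andP => [[j /andP[/eqP <-]]|[lt_in]].
    by rewrite !nth_one_line ltnS => ->; split.
  rewrite -[i.+1]/(val (Ordinal lt_in)) !nth_one_line ltnS => lt_s.
  by exists (Ordinal lt_in); rewrite eqxx.
by case: (_ && _).
Qed.

(** * From mesh occurrences to words *)

Definition same_order (p t : seq nat) : bool :=
  [forall j : 'I_4, forall l : 'I_4,
    (nth 0 t j < nth 0 t l) == (nth 0 p j < nth 0 p l)].

(** The first line above [v] closes the gap: the one before it is not above [v], and differs from
    [v] because [v] is not in [V]. As [M] contains every box of columns 1 and 2, any point of these
    columns off the chosen values thus lies in a shaded box. *)
Lemma gap_exists (V : seq nat) n v : size V = 4 -> v \notin V -> 0 < v <= n ->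
  exists y : 'I_5,
    nth 0 (0 :: rcons V n.+1) y < v < nth 0 (0 :: rcons V n.+1) y.+1.
Proof.
case: V => [|v1 [|v2 [|v3 [|v4 [|]]]]] //= _.
rewrite !inE !negb_or => /and4P[n1 n2 n3 n4] /andP[v0 vn].
case: (ltnP v v1) => c1; first by exists (inord 0); rewrite inordK //= v0.
case: (ltnP v v2) => c2; first by exists (inord 1); rewrite inordK //=; lia.
case: (ltnP v v3) => c3; first by exists (inord 2); rewrite inordK //=; lia.
case: (ltnP v v4) => c4; first by exists (inord 3); rewrite inordK //=; lia.
by exists (inord 4); rewrite inordK //=; lia.
Qed.

Lemma enum4 : enum 'I_4 = [:: inord 0; inord 1; inord 2; inord 3].
Proof.
apply: (inj_map val_inj); rewrite val_enum_ord /= !inordK //.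
Qed.

Lemma contains_wordE n (s : 'S_n) (p : seq nat) (pP : perm_eq p (iota 1 4)) :
  contains (MeshPattern (of_one_line pP) M) s =
  ~~ avoids (fun x y z d => same_order p [:: x; y; z; d]) (one_line s).
Proof.
have patE (j l : 'I_4) :
    (of_one_line pP j < of_one_line pP l) = (nth 0 p j < nth 0 p l).
  by rewrite -ltnS -!nth_one_line of_one_lineK.
apply/existsP/avoidsPn => [[f /and3P[incr iso box]]|[i [d [/andP[lt_id]]]]].
- have {}incr (j l : 'I_4) : j < l -> f j < f l.
    by move=> jl; move/forallP/(_ j)/forallP/(_ l)/implyP: incr; apply.
  have [i iE] : {i : nat -> nat | forall k, f (inord k) = i k :> nat}.
    by exists (fun k => val (f (inord k))).
  have lt_i k l : k < l < 4 -> i k < i l.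
    by case/andP=> ltkl ltl; rewrite -!iE incr // !inordK // (ltn_trans ltkl).
  have [lt01 lt12 lt23] : [/\ i 0 < i 1, i 1 < i 2 & i 2 < i 3].
    by split; apply: lt_i.
  have lt_in k : i k < n by rewrite -iE.
  have posE : pos_lines f =
      [:: 0; (i 0).+1; (i 1).+1; (i 2).+1; (i 3).+1; n.+1].
    by rewrite /pos_lines enum4 /= !iE.
  (* Columns 1 and 2 contain no point at all, so the first three positions are consecutive. *)
  have adj (x : 'I_5) m : val x \in [:: 1; 2] -> m < n ->
     ~ (nth 0 (pos_lines f) x < m.+1 < nth 0 (pos_lines f) x.+1).
    move=> xM lt_mn xm; pose m' := Ordinal lt_mn.
    have [|||y ym] := @gap_exists (sort leq [seq (s (f j)).+1 | j <- enum 'I_4])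
                        n (s m').+1.
    + by rewrite size_sort size_map size_enum_ord.
    (* Position [m] lies strictly between two consecutive chosen positions, so by injectivity of [s]
       its value is not a chosen one. *)
    + rewrite mem_sort; apply/mapP => -[j _ /succn_inj/val_inj/perm_inj].
      move/(congr1 val); rewrite /= -[j]inord_val iE => mE.
      by move: xM xm; rewrite posE mE !inE => /orP[]/eqP-> /=;
        case: (j) => -[|[|[|[|]]]] //= _; lia.
    + by rewrite /= ltn_ord.
    move/forall_inP/(_ (x, y)): box; rewrite inE => /(_ xM)/existsP[].
    by exists m'; rewrite /in_box xm.
  have i1E : i 1 = (i 0).+1.
    have := adj (@Ordinal 5 1 isT) (i 0).+1 isT; rewrite posE /=.
    by have := lt_in 1; lia.
  have i2E : i 2 = (i 1).+1.
    have := adj (@Ordinal 5 2 isT) (i 1).+1 isT; rewrite posE /=.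
    by have := lt_in 2; lia.
  exists (i 0), (i 3); rewrite size_one_line lt_in andbT -i1E -i2E lt23.
  split=> //.
  rewrite -!iE !nth_one_line; apply/forallP => j; apply/forallP => l.
  have := forallP (forallP iso j) l; rewrite patE /= => /eqP <-.
  have sE (k : 'I_4) : nth 0 [:: (s (f (inord 0))).+1; (s (f (inord 1))).+1;
     (s (f (inord 2))).+1; (s (f (inord 3))).+1] k = (s (f k)).+1.
    by rewrite -{2}[k]inord_val; case: (k) => -[|[|[|[|]]]].
  by rewrite !sE ltnS.
rewrite size_one_line => lt_dn ord.
have lt_n : [/\ i < n, i.+1 < n & i.+2 < n] by split; lia.
case: lt_n => lt0 lt1 lt2.
pose g := [:: Ordinal lt0; Ordinal lt1; Ordinal lt2; Ordinal lt_dn].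
pose f := [ffun j : 'I_4 => nth (Ordinal lt0) g j].
have fE (j : 'I_4) : f j = nth 0 [:: i; i.+1; i.+2; d] j :> nat.
  by rewrite ffunE; case: j => -[|[|[|[|]]]] //= _.
have sE (j : 'I_4) : nth 0 [:: nth 0 (one_line s) i; nth 0 (one_line s) i.+1;
     nth 0 (one_line s) i.+2; nth 0 (one_line s) d] j = (s (f j)).+1.
  by rewrite -nth_one_line fE; case: j => -[|[|[|[|]]]] //= _.
exists f; apply/and3P; split.
- apply/forallP => j; apply/forallP => l; apply/implyP; rewrite !fE.
  by case: j => -[|[|[|[|]]]] //= _; case: l => -[|[|[|[|]]]] //= _ => //=; lia.
- apply/forallP => j; apply/forallP => l; rewrite patE.
  by have := forallP (forallP ord j) l; rewrite !sE ltnS.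
(* The vertical lines bounding columns 1 and 2 are at consecutive positions, so the horizontal
   condition of [in_box] already fails. *)
apply/forall_inP => -[x y]; rewrite inE /= => xM.
apply/existsP => -[m /andP[/= xm _]]; move: xM xm.
rewrite /pos_lines enum4 !inE => /orP[]/eqP-> /=; rewrite !fE !inordK //=; lia.
Qed.

Lemma same_orderP p x y z d :
  reflect (forall j l, j < 4 -> l < 4 ->
             (nth 0 [:: x; y; z; d] j < nth 0 [:: x; y; z; d] l) =
             (nth 0 p j < nth 0 p l))
          (same_order p [:: x; y; z; d]).
Proof.
apply: (iffP forallP) => [ord j l ltj ltl|ord j].
  exact: eqP (forallP (ord (Ordinal ltj)) (Ordinal ltl)).
by apply/forallP => l; rewrite ord.
Qed.

(** The three inequalities form a chain through all four letters, hence determine every comparison;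
    the same holds for the other two patterns. *)
Lemma same_order3124 x y z d :
  same_order [:: 3; 1; 2; 4] [:: x; y; z; d] = R3124 x y z d.
Proof.
apply/same_orderP/idP => [ord|].
  by rewrite /R3124 (ord 1 2) // (ord 2 0) // (ord 0 3).
rewrite /R3124 => R j l.
by case: j => [|[|[|[|]]]] //; case: l => [|[|[|[|]]]] //= _ _; lia.
Qed.

Lemma same_order2314 x y z d :
  same_order [:: 2; 3; 1; 4] [:: x; y; z; d] = R2314 x y z d.
Proof.
apply/same_orderP/idP => [ord|].
  by rewrite /R2314 (ord 2 0) // (ord 0 1) // (ord 1 3).
rewrite /R2314 => R j l.
by case: j => [|[|[|[|]]]] //; case: l => [|[|[|[|]]]] //= _ _; lia.
Qed.

Lemma same_order2413 x y z d :
  same_order [:: 2; 4; 1; 3] [:: x; y; z; d] = R2413 x y z d.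
Proof.
apply/same_orderP/idP => [ord|].
  by rewrite /R2413 (ord 2 0) // (ord 0 3) // (ord 3 1).
rewrite /R2413 => R j l.
by case: j => [|[|[|[|]]]] //; case: l => [|[|[|[|]]]] //= _ _; lia.
Qed.

(** * Weights of words and insertion of a first letter *)

Definition weight (R : nat -> nat -> nat -> nat -> bool) (w : seq nat) :
    {poly int} :=
  ((avoids R w)%:R * 'X^(word_des w))%R.

(** Insertion of a first letter of rank [r]: [bump r] raises the letters that are at least [r], so
    that for [0 < r <= n.+1] a permutation of 1, ..., n becomes one of 1, ..., n+1. *)
Definition prepend (r : nat) (w : seq nat) : seq nat := r :: map (bump r) w.

Lemma bump_mono r : {mono bump r : x y / x < y}.
Proof. by move=> x y; rewrite !ltnNge leq_bump2. Qed.

Lemma avoids_map (R R' : nat -> nat -> nat -> nat -> bool) f w :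
  (forall x y z d, x \in w -> y \in w -> z \in w -> d \in w ->
     R' (f x) (f y) (f z) (f d) = R x y z d) ->
  avoids R' (map f w) = avoids R w.
Proof.
elim: w => [|x w IHw] //= eqR; congr (_ && _).
  case: w {IHw} eqR => [|y [|z r]] //= eqR; congr (~~ _).
  rewrite has_map; apply: eq_in_has => d dr /=.
  by apply: eqR; rewrite !inE ?eqxx ?dr ?orbT.
by apply: IHw => *; apply: eqR; rewrite inE; apply/orP; right.
Qed.

Lemma adj_count_map (e e' : rel nat) f w :
  {in w &, forall x y, e' (f x) (f y) = e x y} ->
  adj_count e' (map f w) = adj_count e w.
Proof.
elim: w => [|x w IHw] //= eqe; congr (_ + _).
  by case: w {IHw} eqe => [|y r] //= eqe; rewrite eqe ?inE ?eqxx ?orbT.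
by apply: IHw => y z yw zw; apply: eqe; rewrite inE ?yw ?zw orbT.
Qed.

Lemma one_line_lift_perm n (r : 'I_n.+1) (p : 'S_n) :
  one_line (lift_perm ord0 r p) = prepend r.+1 (one_line p).
Proof.
rewrite /one_line enum_ordSl /= lift_perm_id /prepend; congr (_ :: _).
rewrite -!map_comp; apply: eq_map => i /=.
by rewrite lift_perm_lift /= /bump ltnS -addnS.
Qed.

(** A permutation is determined by its first letter and the standardization of the rest; injectivity
    and the count (n+1)! = (n+1) n! give the bijection. *)
Lemma sum_lift_perm n (f : seq nat -> {poly int}) :
  (\sum_(s : 'S_n.+1) f (one_line s) =
   \sum_(r < n.+1) \sum_(p : 'S_n) f (prepend r.+1 (one_line p)))%R.
Proof.
rewrite pair_big /=.
pose h (rp : 'I_n.+1 * 'S_n) := lift_perm ord0 rp.1 rp.2.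
have h_inj : injective h.
  move=> [r p] [r' p'] /= eq_h.
  have eqr : r = r'.
    rewrite -(lift_perm_id ord0 r p) -(lift_perm_id ord0 r' p').
    by rewrite -/(h (r, p)) eq_h.
  subst r'; congr (_, _); apply/permP => i; apply: (@lift_inj _ r).
  by rewrite -!(lift_perm_lift ord0) -/(h (r, p)) eq_h.
have h_bij : bijective h.
  apply: inj_card_bij h_inj _.
  by rewrite card_prod !card_Sn card_ord factS.
rewrite (reindex h) /=; last exact: onW_bij.
by apply: eq_bigr => -[r p] _; rewrite /h one_line_lift_perm.
Qed.

(** * The recursion on the first letter, for 2314 and 2413 *)

(** This is W(n, r): the words summed over have length [n.+1]. *)
Definition weight_from R n (r : nat) : {poly int} :=
  (\sum_(p : 'S_n) weight R (prepend r (one_line p)))%R.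

Definition order_inv (R : nat -> nat -> nat -> nat -> bool) :=
  forall r x y z d, R (bump r x) (bump r y) (bump r z) (bump r d) = R x y z d.

Lemma weight_bump R r w : order_inv R -> weight R (map (bump r) w) = weight R w.
Proof.
move=> invR; rewrite /weight (@avoids_map R) //.
rewrite /word_des (@adj_count_map (fun x y => y < x)) // => x y _ _.
by rewrite bump_mono.
Qed.

(** The common feature of 2314 and 2413: an occurrence starts with an ascent followed by a letter
    below both. *)
Definition peak_middle (R : nat -> nat -> nat -> nat -> bool) :=
  forall x y z d, R x y z d -> z < x < y.

Lemma weight_descent R x y w : peak_middle R -> y < x ->
  (weight R [:: x, y & w] = 'X * weight R (y :: w))%R.
Proof.
move=> pR lt_yx; rewrite /weight.
have -> : avoids R [:: x, y & w] = avoids R (y :: w).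
  rewrite [LHS]/=; case: w => //= z r; case: hasP => // -[d _ /pR /andP[_]].
  by rewrite ltnNge (ltnW lt_yx).
have -> : word_des [:: x, y & w] = (word_des (y :: w)).+1.
  by rewrite /word_des /= lt_yx.
by rewrite exprS; ring.
Qed.

Lemma weight_ascent R x y w : x < y ->
  weight R [:: x, y & w] =
  (if (if w is z :: r then has (R x y z) r else false)
   then 0 else weight R (y :: w))%R.
Proof.
move=> lt_xy; rewrite /weight.
have -> : word_des [:: x, y & w] = word_des (y :: w).
  by rewrite /word_des /= ltnNge (ltnW lt_xy).
rewrite [avoids R _]/= -/(avoids R (y :: w)).
case: w => [|z r] //=; by case: has => //=; rewrite mul0r.
Qed.

(* Here c and then b are inserted in front of a :: r. They are insertion ranks:
   the final letters are b, c.+1 and a, so that b <= c is the ascent condition. *)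
Definition completes (R : nat -> nat -> nat -> nat -> bool)
    (phi : nat -> rel nat) :=
  forall n (a : nat) (r : seq nat) b c,
    perm_eq (a :: r) (iota 1 n) -> a < b <= c -> c <= n.+1 ->
    has (fun d => R b c.+1 a (bump b (bump c d))) r = phi n b c.

(** At a descent, [b] contributes a factor ['X]. At an ascent it either leaves the weight unchanged
    or creates an occurrence. In the latter case [a < c], so [prepend c (a :: r)] starts with a
    descent and weighs ['X * weight R (a :: r)]; subtracting this gives 0. *)
Lemma weight_prepend2 R phi n (a : nat) (r : seq nat) b c :
  order_inv R -> peak_middle R -> completes R phi ->
  perm_eq (a :: r) (iota 1 n) -> c <= n.+1 ->
  (weight R (prepend b (prepend c (a :: r))) =
   'X ^+ (c < b)%N * weight R (prepend c (a :: r)) -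
   ((a < b <= c)%N && phi n b c)%:R * ('X * weight R (a :: r)))%R.
Proof.
move=> invR pR phiR arP le_cn.
have wE : weight R (bump b c :: map (bump b) (map (bump c) (a :: r))) =
    weight R (prepend c (a :: r)).
  by rewrite -map_cons weight_bump.
have [lt_cb|le_bc] := ltnP c b.
  have bE : bump b c = c by rewrite /bump leqNgt lt_cb.
  rewrite andbF /= mul0r subr0 expr1 -wE bE /prepend /= bE.
  by rewrite weight_descent.
rewrite expr0 mul1r andbT.
have bE : bump b c = c.+1 by rewrite /bump le_bc.
rewrite [prepend b _]/= /prepend weight_ascent ?bE ?ltnS // -bE wE.
(* If [b <= a], the third letter ends up above [b], which [peak_middle] excludes. *)
have [lt_ab|le_ba] /= := ltnP a b; last first.
  rewrite mul0r subr0; case: hasP => // -[d _ /pR] /andP[].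
  by rewrite /bump; lia.
have lt_ac : a < c := leq_trans lt_ab le_bc.
have ac : bump c a = a by rewrite /bump leqNgt lt_ac.
have ab : bump b a = a by rewrite /bump leqNgt lt_ab.
rewrite ac ab bE -!/(map _ _) -map_comp has_map.
have -> : has (preim (bump b \o bump c) (R b c.+1 a)) r = phi n b c.
  by apply: phiR; rewrite ?lt_ab.
rewrite /prepend /= ac (weight_descent _ _ _ _ pR lt_ac).
have -> : weight R (a :: map (bump c) r) = weight R (a :: r).
  by rewrite -{1}ac -map_cons weight_bump.
by case: (phi n b c); rewrite ?mul1r ?subrr ?mul0r ?subr0.
Qed.

(** Sum [weight_prepend2] over [c] and the remaining word. Since [phi] involves neither [a] nor [r],
    the correction factors into the number of harmful [c] and a sum over the first letters below
    [b]. *)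
Lemma weight_from_rec R phi n b :
  order_inv R -> peak_middle R -> completes R phi ->
  (weight_from R n.+2 b =
   \sum_(c < n.+2) 'X ^+ (c.+1 < b)%N * weight_from R n.+1 c.+1 -
   'X * (\sum_(c < n.+2) ((b <= c.+1) && phi n.+1 b c.+1))%N%:R *
     \sum_(a < n.+1) (a.+1 < b)%N%:R * weight_from R n a.+1)%R.
Proof.
move=> invR pR phiR.
rewrite /weight_from (sum_lift_perm n.+1 (fun w => weight R (prepend b w))).
pose W (p : 'S_n.+1) := weight R (one_line p).
pose hd (p : 'S_n.+1) := head 0 (one_line p).
transitivity (\sum_(c < n.+2) \sum_(p : 'S_n.+1)
  ('X ^+ (c.+1 < b)%N * weight R (prepend c.+1 (one_line p)) -
   ((b <= c.+1)%N && phi n.+1 b c.+1)%:R * ((hd p < b)%N%:R * ('X * W p))))%R.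
  apply: eq_bigr => c _; apply: eq_bigr => p _; rewrite /W /hd.
  move: (one_line_perm _ p); case: (one_line p) => [/perm_size //|a r arP].
  rewrite (@weight_prepend2 R phi n.+1) //= -andbA.
  by case: (_ && phi _ _ _); case: (a < b); rewrite ?mul0r ?mul1r.
under eq_bigr do rewrite sumrB -!mulr_sumr.
rewrite sumrB -mulr_suml; congr (_ - _)%R.
rewrite -natr_sum -mulrA mulrCA; congr (_ * _)%R.
transitivity ('X * \sum_(p : 'S_n.+1) (hd p < b)%N%:R * W p)%R.
  by rewrite mulr_sumr; apply: eq_bigr => p _; rewrite mulrCA.
congr (_ * _)%R.
rewrite (sum_lift_perm n (fun w => (head 0%N w < b)%N%:R * weight R w)%R) /=.
by apply: eq_bigr => a _; rewrite mulr_sumr.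
Qed.

Lemma avoids_short R w : size w <= 3 -> avoids R w.
Proof. by case: w => [|x [|y [|z [|]]]]. Qed.

(** The recursion sees [phi] only through the number of harmful [c], so equal counts suffice. *)
Lemma weight_from_eq R R' phi phi' n b :
  order_inv R -> peak_middle R -> completes R phi ->
  order_inv R' -> peak_middle R' -> completes R' phi' ->
  (forall m b, 0 < b -> \sum_(c < m.+1) ((b <= c.+1) && phi m b c.+1) =
               \sum_(c < m.+1) ((b <= c.+1) && phi' m b c.+1)) ->
  0 < b -> weight_from R n b = weight_from R' n b.
Proof.
move=> iR pR cR iR' pR' cR' eq_phi.
have [m] := ubnP n; elim: m n b => // m IHm n b lt_nm b_gt0.
case: n lt_nm => [|[|n]] lt_nm; try by
  apply: eq_bigr => p _;
  rewrite /weight !avoids_short //= size_map size_one_line.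
rewrite (weight_from_rec _ _ _ _ iR pR cR).
rewrite (weight_from_rec _ _ _ _ iR' pR' cR').
rewrite eq_phi //; congr (_ - _ * _)%R; apply: eq_bigr => c _.
  by rewrite IHm.
by rewrite IHm // ltnW.
Qed.

Lemma completes2314 : completes R2314 (fun n b c => c <= n).
Proof.
move=> n a r b c arP /andP[lt_ab le_bc] le_cn; rewrite /R2314.
apply/hasP/idP => [[d dr]|le_cn'].
  have : d \in a :: r by rewrite inE dr orbT.
  by rewrite (perm_mem arP) mem_iota /bump; lia.
(* The largest letter [n] exceeds [a] because [a < b <= c <= n], so it lies in [r]; the two
   insertions raise it to [n.+2], above [c.+1]. *)
exists n; last by rewrite /bump; lia.
have : n \in a :: r by rewrite (perm_mem arP) mem_iota; lia.
by rewrite inE => /orP[/eqP nE|//]; lia.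
Qed.

Lemma completes2413 : completes R2413 (fun n b c => b < c).
Proof.
move=> n a r b c arP /andP[lt_ab le_bc] le_cn; rewrite /R2413.
apply/hasP/idP => [[d dr]|lt_bc].
  by rewrite /bump; lia.
(* The letter [b] becomes [b.+1], just above the inserted [b] and below [c.+1]; it differs from [a]
   because [a < b]. *)
exists b; last by rewrite /bump; lia.
have : b \in a :: r by rewrite (perm_mem arP) mem_iota; lia.
by rewrite inE => /orP[/eqP nE|//]; lia.
Qed.

Lemma sum_leq_ord b n : \sum_(c < n) (b <= c) = n - b.
Proof.
elim: n => [|n IHn]; first by rewrite big_ord0.
by rewrite big_ord_recr /= IHn; case: leqP; lia.
Qed.

Lemma sum_weight2314_2413 n :
  (\sum_(s : 'S_n) weight R2314 (one_line s) =
   \sum_(s : 'S_n) weight R2413 (one_line s))%R.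
Proof.
case: n => [|n].
  by apply: eq_bigr => s _; rewrite /weight !avoids_short // size_one_line.
rewrite (sum_lift_perm n (weight R2314)) (sum_lift_perm n (weight R2413)).
apply: eq_bigr => r _.
apply: (weight_from_eq _ _ _ _ _ _ _ _ completes2314 _ _ completes2413) => //.
- by move=> ? *; rewrite /R2314 !bump_mono.
- by move=> x y z d /andP[].
- by move=> ? *; rewrite /R2413 !bump_mono.
- by rewrite /R2413 => x y z d; lia.
(* With first letter [b.+1], the harmless value is [m.+1] for 2314 and [b.+1] for 2413; both counts
   equal the truncated difference [m - b]. *)
move=> m [//|b] _; rewrite big_ord_recr /= ltnn andbF addn0.
rewrite (eq_bigr (fun c : 'I_m => (b <= c : nat))) => [|c _]; last first.
  by rewrite ltn_ord andbT.
rewrite [RHS](eq_bigr (fun c : 'I_m.+1 => (b.+1 <= c : nat))) => [|c _].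
  by rewrite !sum_leq_ord.
by rewrite !ltnS; case: leqP => //; case: leqP => //; lia.
Qed.

(** * Consecutive patterns and the reverse-complement *)

Fixpoint avoids_triple (T : nat -> nat -> nat -> bool) (w : seq nat) : bool :=
  if w is x :: w' then
    (if w' is y :: z :: _ then ~~ T x y z else true) && avoids_triple T w'
  else true.

Lemma avoids_triple_map (T T' : nat -> nat -> nat -> bool) f w :
  (forall x y z, x \in w -> y \in w -> z \in w ->
     T' (f x) (f y) (f z) = T x y z) ->
  avoids_triple T' (map f w) = avoids_triple T w.
Proof.
elim: w => [|x w IHw] //= eqT; congr (_ && _).
  by case: w {IHw} eqT => [|y [|z r]] //= eqT; rewrite eqT // !inE eqxx ?orbT.
by apply: IHw => *; apply: eqT; rewrite inE; apply/orP; right.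
Qed.

Lemma avoids_triple_cat3 T w x y z :
  avoids_triple T (w ++ [:: x; y; z]) =
  avoids_triple T (w ++ [:: x; y]) && ~~ T x y z.
Proof.
elim: w => [|a w IHw] /=; first by rewrite !andbT.
by rewrite IHw andbA; case: w {IHw} => [|b [|c w]].
Qed.

Lemma avoids_triple_rev T w :
  avoids_triple T (rev w) = avoids_triple (fun x y z => T z y x) w.
Proof.
elim: w => [|x [|y [|z w]] IHw] //.
rewrite -[RHS]/(~~ T z y x && avoids_triple _ [:: y, z & w]) -IHw.
by rewrite !rev_cons -!cats1 -!catA /= avoids_triple_cat3 andbC.
Qed.

Lemma adj_count_cat2 e w x y :
  adj_count e (w ++ [:: x; y]) = adj_count e (w ++ [:: x]) + e x y.
Proof.
elim: w => [|a w IHw] /=; first by rewrite !addn0.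
by rewrite IHw addnA; case: w {IHw}.
Qed.

Lemma adj_count_rev e w : adj_count e (rev w) = adj_count (fun x y => e y x) w.
Proof.
elim: w => [|x [|y w] IHw] //.
rewrite -[RHS]/(e y x + adj_count _ (y :: w)) -IHw.
by rewrite !rev_cons -!cats1 -!catA /= adj_count_cat2 addnC.
Qed.

(** The order-reversing involution on the letters of [u], when these are distinct: the i-th smallest
    goes to the i-th largest. Unlike x -> n+1-x, it keeps the set of letters. *)
Definition complement (u : seq nat) (x : nat) : nat :=
  nth 0 (rev (sort leq u)) (index x (sort leq u)).

Definition reverse_complement (u : seq nat) : seq nat :=
  map (complement u) (rev u).

(** Makes the complement taken in [reverse_complement u] the same as that taken in [u], whence the
    involution. *)
Lemma eq_complement u v : perm_eq u v -> complement u =1 complement v.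
Proof.
move=> uv x; rewrite /complement.
have /perm_sortP -> := uv => //.
- exact: leq_total.
- exact: leq_trans.
- exact: anti_leq.
Qed.

Lemma complementE u x : x \in u ->
  complement u x = nth 0 (sort leq u) (size u - (index x (sort leq u)).+1).
Proof.
move=> xu; rewrite /complement nth_rev ?size_sort //.
by rewrite -(size_sort leq) index_mem mem_sort.
Qed.

Lemma mem_complement u x : x \in u -> complement u x \in u.
Proof.
move=> xu; rewrite complementE // -(mem_sort leq) mem_nth // size_sort.
by rewrite ltn_subrL /=; case: u xu.
Qed.

Lemma complementK u : uniq u -> {in u, involutive (complement u)}.
Proof.
move=> Uu x xu; have lt_i : index x (sort leq u) < size u.
  by rewrite -(size_sort leq) index_mem mem_sort.
rewrite complementE ?mem_complement // complementE // index_uniq ?sort_uniq //.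
  by rewrite subnSK // subKn ?nth_index ?mem_sort // ltnW.
by rewrite size_sort; lia.
Qed.

Lemma ltn_complement u : uniq u ->
  {in u &, forall x y, (complement u x < complement u y) = (y < x)}.
Proof.
move=> Uu; set t := sort leq u.
have st : sorted ltn t.
  by rewrite ltn_sorted_uniq_leq sort_uniq Uu sort_sorted //; exact: leq_total.
have lt_index x y : x \in u -> y \in u -> x < y -> index x t < index y t.
  move=> xu yu; rewrite !ltnNge; apply: contra.
  by apply: (sorted_leq_index leq_trans leqnn (sort_sorted leq_total u));
    rewrite mem_sort.
have antimono x y : x \in u -> y \in u -> x < y ->
    complement u y < complement u x.
  move=> xu yu lt_xy; rewrite !complementE //.
  have := lt_index x y xu yu lt_xy.
  have : index y t < size u by rewrite -(size_sort leq) index_mem mem_sort.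
  have arith N i j : j < N -> i < j ->
      [/\ N - j.+1 < N, N - i.+1 < N & N - j.+1 < N - i.+1] by split; lia.
  move=> lt_iy /(arith _ _ _ lt_iy)[lt1 lt2 lt3].
  by apply: (@sorted_ltn_nth _ ltn ltn_trans) => //; rewrite inE size_sort.
move=> x y xu yu; case: (ltngtP y x) => [lt_yx|lt_xy|->]; last exact: ltnn.
  exact: antimono.
by apply/negbTE; rewrite -leqNgt ltnW // antimono.
Qed.

Lemma perm_reverse_complement u : uniq u -> perm_eq (reverse_complement u) u.
Proof.
move=> Uu; rewrite /reverse_complement.
apply: uniq_perm => //.
  rewrite map_inj_in_uniq ?rev_uniq // => x y; rewrite !mem_rev => xu yu.
  by move/(congr1 (complement u)); rewrite !complementK.
move=> x; rewrite map_rev mem_rev; apply/mapP/idP => [[y yu ->]|xu].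
  exact: mem_complement.
by exists (complement u x); rewrite ?mem_complement ?complementK.
Qed.

Lemma reverse_complementK u : uniq u ->
  reverse_complement (reverse_complement u) = u.
Proof.
move=> Uu; rewrite {1}/reverse_complement.
rewrite (eq_map (eq_complement _ _ (perm_reverse_complement _ Uu))).
rewrite /reverse_complement -map_rev revK -map_comp -[RHS]map_id.
by apply/eq_in_map => x xu /=; rewrite complementK.
Qed.

(** Reversal turns descents into ascents, and the complement turns them back. *)
Lemma word_des_reverse_complement u : uniq u ->
  word_des (reverse_complement u) = word_des u.
Proof.
move=> Uu; rewrite /word_des /reverse_complement.
rewrite (@adj_count_map (fun x y => x < y)) ?adj_count_rev // => x y.
by rewrite !mem_rev => xu yu; rewrite ltn_complement.
Qed.

(** Reversal takes 231 to 132, and the complement takes 132 to 312. *)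
Lemma avoids_triple_reverse_complement u : uniq u ->
  avoids_triple (fun x y z => y < z < x) (reverse_complement u) =
  avoids_triple (fun x y z => z < x < y) u.
Proof.
move=> Uu; rewrite /reverse_complement.
rewrite (@avoids_triple_map (fun x y z => x < z < y)) ?avoids_triple_rev //.
move=> x y z.
by rewrite !mem_rev => xu yu zu; rewrite !ltn_complement // andbC.
Qed.

(** * Cutting at the maximum, for 3124 and 2314 *)

(** When [d] must exceed the other three letters, [m] completes every triple inside [u], while a
    triple containing [m] can never be completed. *)
Lemma avoids_split (R : nat -> nat -> nat -> nat -> bool) T
    (u : seq nat) m (v : seq nat) :
  (forall x y z d, R x y z d = [&& T x y z, x < d, y < d & z < d]) ->
  {in u, forall x, x < m} -> {in v, forall x, x < m} ->
  avoids R (u ++ m :: v) = avoids_triple T u && avoids R v.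
Proof.
move=> RT lt_um lt_vm; elim: u lt_um => [|x u IHu] lt_um.
  rewrite /=; case: v lt_vm => [|y [|z r]] // lt_vm; case: hasP => // -[d dr].
  by rewrite RT (ltnNge m d) (ltnW (lt_vm d _)) ?andbF // !inE dr !orbT.
rewrite [LHS]/= IHu /= => [|y yu]; last by rewrite lt_um // inE yu orbT.
rewrite andbA; congr (_ && _ && _).
(* With fewer than two letters of [u] after [x], the factor starting at [x] reaches [m], and no
   later letter exceeds [m]. *)
case: u lt_um {IHu} => [|y [|z u]] lt_um /=.
- case: v lt_vm => [|z r] // lt_vm; apply/hasPn => d dr.
  by rewrite RT (ltnNge m d) (ltnW (lt_vm d _)) ?andbF // !inE dr !orbT.
- apply/hasPn => d dr.
  by rewrite RT (ltnNge m d) (ltnW (lt_vm d _)) ?andbF.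
congr (~~ _); apply/hasP/idP => [[d _]|Txyz]; first by rewrite RT => /andP[].
exists m; first by rewrite mem_cat inE eqxx orbT.
by rewrite RT Txyz !lt_um // !inE eqxx ?orbT.
Qed.

(** The term [~~ nilp v] is the descent from [m] to the first letter of [v]; entering [m] is always
    an ascent. *)
Lemma word_des_split (u : seq nat) m (v : seq nat) :
  {in u, forall x, x < m} -> {in v, forall x, x < m} ->
  word_des (u ++ m :: v) = word_des u + (~~ nilp v) + word_des v.
Proof.
move=> lt_um lt_vm; rewrite /word_des; elim: u lt_um => [|x u IHu] lt_um.
  by rewrite /=; case: v lt_vm => [|y r] // -> //; rewrite inE eqxx.
rewrite [LHS]/= IHu /= => [|y yu]; last by rewrite lt_um // inE yu orbT.
rewrite !addnA; congr (_ + _ + _ + _).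
case: u lt_um {IHu} => [|y u] lt_um //=.
by rewrite ltnNge ltnW // lt_um // inE eqxx.
Qed.

(* The fuel [k] only has to be at least the length of the word. *)
Fixpoint block_reverse_complement (k : nat) (w : seq nat) : seq nat :=
  if k is k'.+1 then
    if nilp w then w else
    let m := \max_(x <- w) x in
    reverse_complement (take (index m w) w) ++
      m :: block_reverse_complement k' (drop (index m w).+1 w)
  else w.

Lemma block_reverse_complement_cat k (u : seq nat) m (v : seq nat) :
  {in u, forall x, x < m} -> {in v, forall x, x < m} ->
  block_reverse_complement k.+1 (u ++ m :: v) =
  reverse_complement u ++ m :: block_reverse_complement k v.
Proof.
move=> lt_um lt_vm.
have maxE : \max_(x <- u ++ m :: v) x = m.
  apply/eqP; rewrite eqn_leq; apply/andP; split.
    apply/bigmax_leqP_seq => x; rewrite mem_cat inE.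
    by case/or3P=> [/lt_um/ltnW|/eqP->|/lt_vm/ltnW].
  by apply: (@leq_bigmax_seq _ _ _ id m); rewrite // mem_cat inE eqxx orbT.
have indexE : index m (u ++ m :: v) = size u.
  rewrite index_cat /= eqxx addn0; case: ifP => // /lt_um; by rewrite ltnn.
rewrite [LHS]/=.
have -> : nilp (u ++ m :: v) = false by rewrite /nilp size_cat addnS.
rewrite maxE indexE take_size_cat // -(cat_rcons m u v).
by rewrite drop_size_cat ?size_rcons.
Qed.

Lemma split_max (w : seq nat) : uniq w -> w != [::] ->
  exists u m v, [/\ w = u ++ m :: v, {in u, forall x, x < m} &
                    {in v, forall x, x < m}].
Proof.
move=> Uw w_n0; have /hasP[m mw max_m] :
    has (fun m => all (fun x => x <= m) w) w.
  elim: w w_n0 {Uw} => [|x [|y w] IHw] // _; first by rewrite /= leqnn.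
  have /hasP[m mw max_m] := IHw isT.
  have [le_xm|lt_mx] := leqP x m.
    by apply/hasP; exists m; [rewrite in_cons mw orbT | rewrite /= le_xm].
  apply/hasP; exists x; first by rewrite inE eqxx.
  rewrite [all _ _]/= leqnn.
  by apply: sub_all max_m => z /leq_trans -> //; apply: ltnW.
case/splitPr: mw Uw max_m => u v; rewrite cat_uniq /= all_cat /=.
case/and4P=> _ /norP[mu _] mv _ /and3P[/allP le_um _ /allP le_vm].
exists u, m, v; split=> // x xw; rewrite ltn_neqAle.
  by rewrite (le_um x xw) andbT; apply: contraNneq mu => <-.
by rewrite (le_vm x xw) andbT; apply: contraNneq mv => <-.
Qed.

Lemma block_reverse_complementP k w : uniq w -> size w <= k ->
  let B := block_reverse_complement k in
  [/\ perm_eq (B w) w, B (B w) = w, word_des (B w) = word_des w &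
      avoids R3124 (B w) = avoids R2314 w].
Proof.
elim: k w => [|k IHk] w Uw le_wk; first by case: w Uw le_wk.
have [->|w_n0] := eqVneq w [::]; first by [].
have [u [m [v [wE lt_um lt_vm]]]] := split_max w Uw w_n0.
move: Uw le_wk; rewrite wE cat_uniq size_cat addnS ltnS.
move=> /and3P[Uu _ /andP[_ Uv]] /(leq_trans (leq_addl _ _)) le_vk.
have [Pv Kv dv av] := IHk v Uv le_vk.
have Pu := perm_reverse_complement _ Uu.
have lt_rm : {in reverse_complement u, forall x, x < m}.
  by move=> x; rewrite (perm_mem Pu); apply: lt_um.
have lt_bm : {in block_reverse_complement k v, forall x, x < m}.
  by move=> x; rewrite (perm_mem Pv); apply: lt_vm.
cbv zeta.
(* Both sides of [m] keep their letters, so the second application cuts at the same [m]. *)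
rewrite block_reverse_complement_cat // block_reverse_complement_cat //.
split.
- by rewrite perm_cat // perm_cons.
- by rewrite reverse_complementK // Kv.
- rewrite !word_des_split // word_des_reverse_complement // dv.
  by rewrite /nilp (perm_size Pv).
rewrite (@avoids_split _ (fun x y z => y < z < x)) //; last first.
  by move=> *; rewrite /R3124; lia.
rewrite (@avoids_split _ (fun x y z => z < x < y)) //; last first.
  by move=> *; rewrite /R2314; lia.
by rewrite avoids_triple_reverse_complement // av.
Qed.

(** Reindexing along the involution that [block_reverse_complement n] induces on ['S_n]. *)
Lemma sum_weight3124_2314 n :
  (\sum_(s : 'S_n) weight R3124 (one_line s) =
   \sum_(s : 'S_n) weight R2314 (one_line s))%R.
Proof.
have BP (s : 'S_n) :
    let B := block_reverse_complement n in let w := one_line s in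
    [/\ perm_eq (B w) (iota 1 n), B (B w) = w, word_des (B w) = word_des w &
        avoids R3124 (B w) = avoids R2314 w].
  have P := one_line_perm n s; have Us : uniq (one_line s).
    by rewrite (perm_uniq P) iota_uniq.
  case: (block_reverse_complementP n _ Us); first by rewrite size_one_line.
  by split=> //; apply: perm_trans P.
have wP s := let: And4 sP _ _ _ := BP s in sP.
pose h s := of_one_line (wP s).
have hE s : one_line (h s) = block_reverse_complement n (one_line s).
  exact: of_one_lineK.
have hK : involutive h.
  by move=> s; apply: one_line_inj; rewrite !hE; case: (BP s).
rewrite (reindex_inj (inv_inj hK)); apply: eq_bigr => s _.
by rewrite hE /weight; case: (BP s) => _ _ -> ->.
Qed.

(** * Descent polynomials as sums of weights *)

Lemma des_polyE n p (pP : perm_eq p (iota 1 4)) R :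
  (forall x y z d, same_order p [:: x; y; z; d] = R x y z d) ->
  des_poly n (MeshPattern (of_one_line pP) M) =
  (\sum_(s : 'S_n) weight R (one_line s))%R.
Proof.
move=> pR; rewrite /des_poly big_mkcond; apply: eq_bigr => s _.
rewrite inE contains_wordE negbK desE /weight.
have -> : avoids (fun x y z d => same_order p [:: x; y; z; d]) (one_line s) =
    avoids R (one_line s).
  (* Mapping the identity makes [avoids_map] an extensionality principle in [R]. *)
  rewrite -[in LHS](map_id (one_line s)); exact: avoids_map.
by case: avoids; rewrite ?mul1r ?mul0r.
Qed.

Theorem theorem3p2 (n : nat) (n_ge1 : 1 <= n) :
  des_poly n (MeshPattern p3124 M) = des_poly n (MeshPattern p2314 M) /\
  des_poly n (MeshPattern p2314 M) = des_poly n (MeshPattern p2413 M).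
Proof.
rewrite (des_polyE _ _ _ _ same_order3124) (des_polyE _ _ _ _ same_order2314).
rewrite (des_polyE _ _ _ _ same_order2413).
by rewrite sum_weight3124_2314 sum_weight2314_2413.
Qed.
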